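(* Let $n\ge1$ be an integer. For all $f,g\in C_b[0,\infty)$ and all $x\in[0,\infty)$, $$|T(f,g;x)|\le\frac12\left(1-\frac1{4^n}\binom{2n}n\right)\cdot osc_{H_n}(f)\cdot osc_{H_n}(g).$$
   Context: $C_b[0,\infty)$ is the set of continuous bounded real-valued functions on $[0,\infty)$. $H_n$ is the Bleimann–Butzer–Hahn operator $H_n(f;x):=\frac1{(1+x)^n}\sum_{k=0}^nf\left(\frac k{n-k+1}\right)\binom nkx^k$, $x\ge0$, and $T(f,g;x):=H_n(fg;x)-H_n(f;x)H_n(g;x)$. The oscillation is $osc_{H_n}(f):=\sup\{|f_k-f_l|:0\le k<l\le n\}$ with $f_k:=f\left(\frac k{n-k+1}\right)$, and similarly for $g$. *)

(* Defs.v *)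
From HB Require Import structures.
From mathcomp Require Import all_boot all_order all_algebra.
From mathcomp Require Import all_classical all_reals all_analysis.
Export numFieldNormedType.Exports.
Export Order.TTheory GRing.Theory Num.Theory.

Set Implicit Arguments.
Unset Strict Implicit.
Unset Printing Implicit Defensive.

Local Open Scope classical_set_scope.
Local Open Scope ring_scope.

(* The function space C_b[0, +oo). A real function on [0, +oo) is represented by
   a total function R -> R, of which only the values on [0, +oo) matter:
   continuity is for the subspace topology (one-sided at 0). *)
Definition Cb {R : realType} : set (R -> R) :=
  [set f : R -> R | {within `[0, +oo[, continuous f} /\ [bounded f x | x in `[0, +oo[]].

(* For k <= n, the only case used below, the truncated subtraction is exact. *)
Definition BBH_node (R : realType) (n k : nat) : R :=
  k%:R / (n - k + 1)%N%:R.

(* BBH n is the Bleimann-Butzer-Hahn operator H_n. *)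
Definition BBH {R : realType} (n : nat) (f : R -> R) (x : R) : R :=
  1 / (1 + x) ^+ n *
  \sum_(0 <= k < n.+1) f (BBH_node R n k) * 'C(n, k)%:R * x ^+ k.

Definition BBH_T {R : realType} (n : nat) (f g : R -> R) (x : R) : R :=
  BBH n (f \* g) x - BBH n f x * BBH n g x.

(* The set is finite, and nonempty as soon as n >= 1, so that the real-valued
   sup is the actual supremum. *)
Definition osc_BBH {R : realType} (n : nat) (f : R -> R) : R :=
  sup [set r : R | exists k l : nat,
    [/\ (k < l)%N, (l <= n)%N &
        r = `|f (BBH_node R n k) - f (BBH_node R n l)|]].

(* Main.v *)
Require Import Defs.
From mathcomp Require Import all_boot all_order all_algebra.
From mathcomp Require Import all_classical all_reals all_analysis.
From mathcomp Require Import zify ring.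

(** With [p k = 'C(n, k) x^k / (1 + x)^n], the quantity [T(f, g; x)] is the
    covariance [1/2 \sum_(k, l) p k p l (f_k - f_l) (g_k - g_l)]. The diagonal
    vanishes, so it is at most [1/2 (1 - \sum_k (p k)^2) osc f osc g], and it
    remains to see that [\sum_k (p k)^2] is at least ['C(2n, n) / 4^n].
    Comparing the coefficients of [z^n] in
    [((1 + x z) (z + x))^n = (x (1 + z)^2 + (1 - x)^2 z)^n] gives
    [\sum_k 'C(n, k)^2 x^(2k)
       = \sum_j 'C(n, j) ((1 - x)^2)^(n - j) x^j 'C(2j, j)].
    As ['C(2j, j) / 4^j] decreases with [j], the right-hand side is at least
    ['C(2n, n) / 4^n] times
    [\sum_j 'C(n, j) ((1 - x)^2)^(n - j) (4x)^j = (1 + x)^(2n)]. *)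

Local Open Scope classical_set_scope.
Local Open Scope ring_scope.

(** Pascal's rule and the symmetry of row [2j + 1] turn the left side into
    [2 ('C(2j, j) + 'C(2j, j + 1))], and the second coefficient is at most the central one. *)
Lemma central_binS_le (j : nat) : ('C(2 * j.+1, j.+1) <= 4 * 'C(2 * j, j))%N.
Proof.
have le_mid : ('C(2 * j, j.+1) <= 'C(2 * j, j))%N.
  rewrite -(leq_pmul2l (ltn0Sn j)) mul_bin_left leq_mul2r.
  by apply/orP; right; lia.
have -> : (2 * j.+1 = (2 * j).+2)%N by lia.
rewrite binS; have : 'C((2 * j).+1, j) = 'C((2 * j).+1, j.+1).
  by rewrite -bin_sub; [congr binomial|]; lia.
rewrite binS; lia.
Qed.

Lemma central_bin_expn_le (j n : nat) : (j <= n)%N ->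
  (4 ^ j * 'C(2 * n, n) <= 4 ^ n * 'C(2 * j, j))%N.
Proof.
move=> /subnK <-; elim: (n - j)%N => [|d IHd]; first by rewrite add0n.
rewrite addSn expnS.
have := central_binS_le (d + j); set a := 'C(_, _); set b := 'C(_, _) in IHd *.
move=> le_ab; apply: leq_trans (_ : 4 ^ j * (4 * b) <= _)%N.
  by rewrite leq_mul2l le_ab orbT.
by rewrite mulnCA -mulnA leq_mul2l IHd orbT.
Qed.

Lemma sum_sqr_bin_expr (R : comNzRingType) (x : R) (n : nat) :
  \sum_(k < n.+1) ('C(n, k)%:R * x ^+ k) ^+ 2 =
  \sum_(j < n.+1)
     'C(n, j)%:R * ((1 - x) ^+ 2) ^+ (n - j) * x ^+ j * 'C(2 * j, j)%:R.
Proof.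
pose P : {poly R} := (1 + x%:P * 'X) ^+ n.
pose Q : {poly R} := ('X + x%:P) ^+ n.
have coefP (k : nat) : (k <= n)%N -> P`_k = 'C(n, k)%:R * x ^+ k.
  move=> le_kn.
  have -> : P = \poly_(i < n.+1) ('C(n, i)%:R * x ^+ i).
    rewrite poly_def /P exprDn; apply: eq_bigr => i _.
    by rewrite expr1n mul1r exprMn -rmorphXn /= -mul_polyC rmorphM /=
      rmorph_nat -mulrnAl mulr_natl.
  by rewrite coef_poly ltnS le_kn.
(* [Q] is [P] with its coefficients reversed, so the convolution for the coefficient of ['X^n] in
   [P * Q] pairs equal terms and produces squares. *)
have coefQ (k : nat) : (k <= n)%N -> Q`_(n - k) = 'C(n, k)%:R * x ^+ k.
  move=> le_kn; rewrite /Q exprDn coef_sum (bigD1 (Ordinal (_ : k < n.+1)%N)) //=.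
  rewrite -rmorphXn /= coefMn coefMC coefXn eqxx mul1r big1 ?addr0 ?mulr_natl //.
  move=> i neq_ik; rewrite -rmorphXn /= coefMn coefMC coefXn.
  have /negPf-> : (n - k != n - i)%N; last by rewrite mul0r mul0rn.
  by have := ltn_ord i; move: neq_ik; rewrite -val_eqE /=; lia.
transitivity ((P * Q)`_n).
  rewrite coefM; apply: eq_bigr => k _.
  have le_kn : (k <= n)%N by rewrite -ltnS.
  by rewrite coefP // coefQ.
have -> : P * Q = (((1 - x) ^+ 2)%:P * 'X + x%:P * ('X + 1) ^+ 2) ^+ n.
  rewrite -exprMn; congr (_ ^+ _); rewrite rmorphXn rmorphB /=; ring.
rewrite exprDn coef_sum; apply: eq_bigr => j _.
have le_jn : (j <= n)%N by rewrite -ltnS.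
(* The factor ['X^(n - j)] shifts degrees, leaving the middle coefficient, of index
   [n - (n - j) = j], of [('X + 1) ^+ (2 * j)]. *)
rewrite !exprMn -!rmorphXn /= coefMn -mulrA coefCM mulrCA coefCM.
rewrite -exprD addnn -mul2n coefXnM ltnNge leq_subr /= subKn // -mulrnAr.
have -> : (('X + 1 : {poly R}) ^+ (2 * j))`_j = 'C(2 * j, j)%:R.
  rewrite exprDn coef_sum.
  have lt_j : (j < (2 * j).+1)%N by lia.
  rewrite (bigD1 (Ordinal lt_j)) //= expr1n mulr1 coefMn coefXn.
  have -> : (j == 2 * j - j :> nat)%N by lia.
  rewrite big1 ?addr0 // => i; rewrite -val_eqE /= => neq_ij.
  rewrite expr1n mulr1 coefMn coefXn.
  have /negPf-> : (j != 2 * j - i :> nat)%N; last by rewrite mul0rn.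
  by have := ltn_ord i; lia.
by rewrite -exprMn -expr2 -[_ * _ *+ _]mulr_natl mulrCA !mulrA.
Qed.

Lemma sum_sqr_bin_expr_ge (R : realFieldType) (x : R) (n : nat) : 0 <= x ->
  'C(2 * n, n)%:R / 4 ^+ n * ((1 + x) ^+ n) ^+ 2 <=
  \sum_(k < n.+1) ('C(n, k)%:R * x ^+ k) ^+ 2.
Proof.
move=> x_ge0; rewrite sum_sqr_bin_expr exprAC.
(* With this splitting both sides expand over the same index [j], and the inequality can be checked
   term by term. *)
have -> : (1 + x) ^+ 2 = (1 - x) ^+ 2 + 4 * x by ring.
rewrite (exprDn (_ ^+ 2)) mulr_sumr; apply: ler_sum => j _.
set d := ((1 - x) ^+ 2) ^+ (n - j).
have : 0 <= d by rewrite exprn_ge0 ?sqr_ge0.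
move: d => d d_ge0.
rewrite (exprMn j 4) -[_ * _ *+ _]mulr_natl.
have -> : 'C(2 * n, n)%:R / 4 ^+ n * ('C(n, j)%:R * (d * (4 ^+ j * x ^+ j))) =
  'C(n, j)%:R * d * x ^+ j * (4 ^+ j * 'C(2 * n, n)%:R / 4 ^+ n) :> R by ring.
apply: ler_wpM2l; first by rewrite !mulr_ge0 ?ler0n ?exprn_ge0.
rewrite ler_pdivrMr ?exprn_gt0 // [leRHS]mulrC -!natrX -!natrM ler_nat.
by rewrite central_bin_expn_le // -ltnS.
Qed.

(** The bounds are asked off the diagonal only, matching an oscillation over distinct indices.
    Removing the diagonal from the double sum is what subtracts [\sum_i p i ^+ 2] from the total
    mass [1]. *)
Lemma covariance_le (R : realFieldType) (I : finType) (p f g : I -> R)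
    (A B : R) :
  (forall i, 0 <= p i) -> \sum_i p i = 1 ->
  (forall i j, i != j -> `|f i - f j| <= A) ->
  (forall i j, i != j -> `|g i - g j| <= B) ->
  `|\sum_i p i * (f i * g i) - (\sum_i p i * f i) * (\sum_i p i * g i)| <=
    1 / 2 * (1 - \sum_i p i ^+ 2) * A * B.
Proof.
move=> p_ge0 p1 leA leB.
have sumE (u v : I -> R) :
    (\sum_i u i) * (\sum_j v j) = \sum_i \sum_j u i * v j.
  by rewrite mulr_suml; apply: eq_bigr => i _; rewrite mulr_sumr.
have covE : \sum_i p i * (f i * g i) - (\sum_i p i * f i) * (\sum_i p i * g i)
    = 1 / 2 * \sum_i \sum_j p i * p j * ((f i - f j) * (g i - g j)).
  have -> : \sum_i \sum_j p i * p j * ((f i - f j) * (g i - g j)) =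
    (\sum_i p i * (f i * g i)) * (\sum_j p j)
    + (\sum_i p i) * (\sum_j p j * (f j * g j))
    - (\sum_i p i * f i) * (\sum_j p j * g j)
    - (\sum_i p i * g i) * (\sum_j p j * f j).
    rewrite !sumE -big_split /= -!sumrB; apply: eq_bigr => i _.
    rewrite -big_split /= -!sumrB; apply: eq_bigr => j _; ring.
  by rewrite p1; field.
have offdiagE : 1 - \sum_i p i ^+ 2 = \sum_i \sum_(j | j != i) p i * p j.
  rewrite -[X in X - _](mulr1 1) -{1 2}p1 sumE -sumrB; apply: eq_bigr => i _.
  by rewrite (bigD1 i) //= expr2 addrC addrK.
have : 0 <= 1 / 2 :> R by rewrite divr_ge0 ?ler0n.
rewrite covE offdiagE; move: (1 / 2) => h h_ge0.
rewrite normrM ger0_norm // -!mulrA ler_wpM2l //.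
rewrite mulr_suml; apply: le_trans (ler_norm_sum _ _ _) _.
apply: ler_sum => i _; rewrite (bigD1 i) //= !subrr mulr0 mulr0 add0r mulr_suml.
apply: le_trans (ler_norm_sum _ _ _) _; apply: ler_sum => j neq_ji.
rewrite normrM (ger0_norm (mulr_ge0 _ _)) //.
apply: ler_wpM2l; first exact: mulr_ge0.
by rewrite normrM ler_pM ?normr_ge0 // ?leA ?leB // eq_sym.
Qed.

Lemma osc_BBH_ge (R : realType) (n : nat) (f : R -> R) (i j : 'I_n.+1) :
  i != j -> `|f (BBH_node R n i) - f (BBH_node R n j)| <= osc_BBH n f.
Proof.
wlog lt_ij : i j / (i < j)%N => [th neq_ij|_].
  have [|lt_ji|/val_inj eq_ij] := ltngtP i j; first by move=> /th; apply.
    by rewrite distrC th // eq_sym.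
  by rewrite eq_ij eqxx in neq_ij.
apply: ub_le_sup; last by exists i, j; split; rewrite // -ltnS.
(* The supremum bounds its set only once the set is known to be bounded above; [M] dominates every
   [|f_k|], hence [M + M] every difference. *)
pose M := \sum_(k < n.+1) `|f (BBH_node R n k)|.
have le_M (k : nat) : (k <= n)%N -> `|f (BBH_node R n k)| <= M.
  rewrite -ltnS => lt_kn.
  by rewrite /M (bigD1 (Ordinal lt_kn)) //= lerDl sumr_ge0.
exists (M + M) => _ [k [l [lt_kl le_ln ->]]].
by rewrite (le_trans (ler_normB _ _)) // lerD // le_M // ltnW ?(leq_trans lt_kl).
Qed.

Lemma BBH_sum (R : realType) (n : nat) (f : R -> R) (x : R) :
  BBH n f x = \sum_(k < n.+1)
    ('C(n, k)%:R * x ^+ k / (1 + x) ^+ n) * f (BBH_node R n k).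
Proof.
rewrite /BBH big_mkord mulr_sumr; apply: eq_bigr => k _; ring.
Qed.

Theorem theorem8p1 (R : realType) (n : nat) (hn : (1 <= n)%N)
    (f g : R -> R) (hf : Cb f) (hg : Cb g) (x : R) (hx : 0 <= x) :
  `|BBH_T n f g x| <=
    1 / 2 * (1 - 1 / 4 ^+ n * 'C(2 * n, n)%:R) * osc_BBH n f * osc_BBH n g.
Proof.
pose p (k : 'I_n.+1) : R := 'C(n, k)%:R * x ^+ k / (1 + x) ^+ n.
have X_gt0 : 0 < (1 + x) ^+ n by rewrite exprn_gt0 // ltr_pwDl.
have p_ge0 k : 0 <= p k.
  by rewrite divr_ge0 ?mulr_ge0 ?ler0n ?exprn_ge0 ?addr_ge0.
have p1 : \sum_k p k = 1.
  rewrite -mulr_suml -[RHS](divff (lt0r_neq0 X_gt0)); congr (_ / _).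
  rewrite exprDn; apply: eq_bigr => k _.
  by rewrite expr1n mul1r mulr_natl.
have sum_p2 : 1 / 4 ^+ n * 'C(2 * n, n)%:R <= \sum_k p k ^+ 2.
  under eq_bigr do rewrite /p expr_div_n.
  rewrite -mulr_suml ler_pdivlMr 1?exprn_gt0 // div1r [_^-1 * _]mulrC.
  exact: sum_sqr_bin_expr_ge.
(* As [n >= 1], the indices [0] and [n] are distinct. The signs obtained here allow
   [\sum_k p k ^+ 2] to be replaced by its lower bound inside the product. *)
have osc_ge0 (h : R -> R) : 0 <= osc_BBH n h.
  have neq0n : ord0 != ord_max :> 'I_n.+1 by rewrite -val_eqE /= neq_ltn hn.
  exact: le_trans (normr_ge0 _) (osc_BBH_ge R n h _ _ neq0n).
rewrite /BBH_T !BBH_sum.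
apply: le_trans (covariance_le _ _ _ _ _ _ _ p_ge0 p1
  (osc_BBH_ge R n f) (osc_BBH_ge R n g)) _.
by rewrite !ler_wpM2r // ler_wpM2l ?divr_ge0 ?ler0n // lerB.
Qed.
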